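(* Let $\mathbf f=(f_1,\dots,f_n)\in\mathcal G_0^n$. (1) If $\mathbf f\in\mathcal{LIN}_n$, then the interior $L_{\mathbf f}(\mathcal G_0)^\circ$ (in $\mathbb R^n$) is a convex set containing $0$, and $$L_{\mathbf f}(\mathcal G_0)^\circ=L_{\mathbf f}\big(\{g\in\mathcal G_0:(f_1,\dots,f_n,g)\in\mathcal{LIN}_{n+1}\}\big)^\circ .$$ (2) If $\mathbf f\in\mathcal{LIN}_n^+$, then $L_{\mathbf f}(\mathcal G_{00})^\circ$ is a convex subset of $\mathbb R^n$ containing $0$, and $$L_{\mathbf f}(\mathcal G_0)^\circ=L_{\mathbf f}\big(\{g\in\mathcal G_0:(f_1,\dots,f_n,g)\in\mathcal{LIN}_{n+1}^+\}\big)^\circ .$$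
   Context: Let $\mathcal G$ be the group of strictly increasing continuous maps $f:[-1,1]\to[-1,1]$ with $f(\pm1)=\pm1$, $i$ the identity, $\mathcal G_0=\{f\in\mathcal G:\int_{-1}^1 f=0\}$, $\mathcal G_{00}$ the odd elements of $\mathcal G$. For a continuous $f$ on $[-1,1]$ let $f^e(t)=\tfrac12(f(t)+f(-t))$ (its even part). $\mathcal{LIN}_n$ is the set of $(f_1,\dots,f_n)\in\mathcal G_0^n$ such that $\{i,f_1,\dots,f_n\}$ is linearly independent in $C([-1,1])$; $\mathcal{LIN}_n^+$ is the set of $(f_1,\dots,f_n)\in\mathcal G_0^n$ such that $\{f_1^e,\dots,f_n^e\}$ is linearly independent. For $\mathbf f\in\mathcal G^n$ the linear map $L_{\mathbf f}:C([-1,1])\to\mathbb R^n$ is $L_{\mathbf f}(g)=\big(\int_{-1}^1 g(f_1^{-1}(t))\,dt,\dots,\int_{-1}^1 g(f_n^{-1}(t))\,dt\big)$. *)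

(* Defs.v *)
From HB Require Import structures.
From mathcomp Require Import all_boot all_order all_algebra.
From mathcomp Require Import all_classical all_reals all_analysis.
Set Implicit Arguments. Unset Strict Implicit. Unset Printing Implicit Defensive.
Import Order.TTheory GRing.Theory Num.Theory.
Import numFieldNormedType.Exports.
Local Open Scope classical_set_scope.
Local Open Scope ring_scope.

Section Defs.
Variable R : realType.

Definition I11 : set R := `[-1, 1]%classic.

(* f in G : strictly increasing continuous map [-1,1] -> [-1,1] fixing -1 and 1.
   Only the values on [-1,1] matter. *)
Definition inG (f : R -> R) : Prop :=
  {within I11, continuous f} /\
  (forall x, I11 x -> I11 (f x)) /\
  (forall x y, I11 x -> I11 y -> x < y -> f x < f y) /\
  f (-1) = -1 /\ f 1 = 1.

Definition int11 (g : R -> R) : R :=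
  fine (\int[@lebesgue_measure R]_(t in I11) (g t)%:E)%E.

Definition inG0 (f : R -> R) : Prop := inG f /\ int11 f = 0.

Definition inG00 (f : R -> R) : Prop :=
  inG f /\ (forall t, I11 t -> f (- t) = - f t).

Definition even_part (f : R -> R) : R -> R := fun t => (f t + f (- t)) / 2.

(* inverse of f on [-1,1] (well-defined for f in G and t in [-1,1]) *)
Definition finv (f : R -> R) (t : R) : R :=
  xget 0 [set x | I11 x /\ f x = t].

Definition lin_indep (m : nat) (h : 'I_m -> R -> R) : Prop :=
  forall c : 'I_m -> R,
    (forall t, I11 t -> \sum_(i < m) c i * h i t = 0) -> forall i, c i = 0.

Definition with_id (n : nat) (f : 'I_n -> R -> R) : 'I_n.+1 -> R -> R :=
  fun i => if unlift ord0 i is Some j then f j else id.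

Definition ext (n : nat) (f : 'I_n -> R -> R) (g : R -> R) : 'I_n.+1 -> R -> R :=
  fun i => if unlift ord_max i is Some j then f j else g.

Definition LIN (n : nat) (f : 'I_n -> R -> R) : Prop :=
  (forall i, inG0 (f i)) /\ lin_indep (with_id f).

Definition LINp (n : nat) (f : 'I_n -> R -> R) : Prop :=
  (forall i, inG0 (f i)) /\ lin_indep (fun i => even_part (f i)).

Definition Lf (n : nat) (f : 'I_n -> R -> R) (g : R -> R) : 'rV[R]_n :=
  \row_(i < n) int11 (fun t => g (finv (f i) t)).

End Defs.

(* Main.v *)
From Pilot Require Import Defs.
From HB Require Import structures.
From mathcomp Require Import all_boot all_order all_algebra.
From mathcomp Require Import all_classical all_reals all_analysis.
From mathcomp Require Import measurable_realfun ring lra.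
Set Implicit Arguments.
Unset Strict Implicit.
Unset Printing Implicit Defensive.
Import Order.TTheory GRing.Theory Num.Theory.
Import numFieldNormedType.Exports.
Local Open Scope classical_set_scope.
Local Open Scope ring_scope.

(** [L_f] is affine on the convex sets [G_0] and [G_00] and kills the identity, so
    the images are convex and contain 0. The i-th coordinate of [L_f g] is the
    Stieltjes integral of [g] against [df_i]. On the ramps [max(x - a, 0)] it is a
    function of [a] with derivative [f_i(a) - 1]; hence a linear relation between
    the coordinates on combinations of ramps vanishing at 1 gives a relation
    between [i, f_1, ..., f_n] (with antisymmetrized ramps: between the even parts
    of the [f_i]). Linear independence therefore yields Lipschitz test functions
    dual to the coordinates, and the maps [i + small combination] fill a
    neighbourhood of 0.

    For the equality, an interior value [v] satisfies [(1 + c) v = L_f g] with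
    [c > 0], so [v] is attained at [(g + c i) / (1 + c)], whose slope is bounded
    below. It is then also attained at a perturbation by an even polynomial in the
    kernel of [L_f] lying outside a prescribed finite-dimensional space, and one of
    these two maps is independent of the given ones. *)

(* [finv] without qualifier would be the inverse from [fingraph]. *)
Local Notation finv := Pilot.Defs.finv.

(** * Integration of continuous functions on [-1,1] *)

Section Integration.
Variable R : realType.
Implicit Types (f g h k : R -> R) (a b c x y : R).

Lemma I11P x : I11 x <-> -1 <= x <= 1.
Proof. by rewrite /I11 /= in_itv. Qed.

Lemma I11N x : I11 x -> I11 (- x).
Proof. by move=> /I11P ?; apply/I11P; lra. Qed.

Lemma I11_m1 : I11 (-1 : R). Proof. by apply/I11P; lra. Qed.
Lemma I11_1 : I11 (1 : R). Proof. by apply/I11P; lra. Qed.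

(** Epsilon-delta form of continuity relative to [-1,1], suited to direct estimates; values outside
    the interval never enter. *)
Definition cont11 g := forall x, I11 x -> forall e, 0 < e ->
  exists2 d, 0 < d & forall y, I11 y -> `|x - y| < d -> `|g x - g y| < e.

Lemma cont11P g : cont11 g <-> {within @I11 R, continuous g}.
Proof.
rewrite subspace_continuousP; split=> cg x Ix.
- apply/cvgrPdist_lt => e e0; have [d d0 gd] := cg _ Ix _ e0.
  rewrite near_withinE; apply/nbhs_normP; exists d => //= y xy Iy.
  exact: gd.
- move=> e e0; have /cvgrPdist_lt/(_ e e0) := cg _ Ix.
  rewrite near_withinE => /nbhs_normP[d /= d0 gd]; exists d => // y Iy xy.
  exact: gd.
Qed.

Lemma cont11_comp g k : cont11 g -> cont11 k -> (forall x, I11 x -> I11 (k x)) ->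
  cont11 (fun x => g (k x)).
Proof.
move=> cg ck kI x Ix e e0; have [d d0 gd] := cg _ (kI _ Ix) _ e0.
have [d' d'0 kd] := ck _ Ix _ d0; exists d' => // y Iy xy.
by apply: gd; [exact: kI|exact: kd].
Qed.

Definition lip11 g K := forall x y, I11 x -> I11 y -> `|g x - g y| <= K * `|x - y|.

Lemma lip11_cont g K : lip11 g K -> cont11 g.
Proof.
move=> gK x Ix e e0; have K0 : 0 < `|K| + 1 by have := normr_ge0 K; lra.
exists (e / (`|K| + 1)) => [|y Iy]; first exact: divr_gt0.
rewrite ltr_pdivlMr// => xy; apply: le_lt_trans (gK _ _ Ix Iy) _.
apply: le_lt_trans xy; rewrite mulrC ler_wpM2l//.
by have := ler_norm K; lra.
Qed.

Lemma cont11D g k : cont11 g -> cont11 k -> cont11 (fun x => g x + k x).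
Proof.
move=> cg ck x Ix e e0; have e20 : 0 < e / 2 by lra.
have [d d0 gd] := cg _ Ix _ e20; have [d' d'0 kd] := ck _ Ix _ e20.
exists (Num.min d d') => [|y Iy]; first by rewrite lt_min d0.
rewrite lt_min => /andP[/(gd _ Iy) H1 /(kd _ Iy) H2].
rewrite (_ : _ - _ = (g x - g y) + (k x - k y)); last by ring.
by apply: le_lt_trans (ler_normD _ _) _; lra.
Qed.

Lemma cont11Z c g : cont11 g -> cont11 (fun x => c * g x).
Proof.
move=> cg x Ix e e0; have c0 : 0 < `|c| + 1 by have := normr_ge0 c; lra.
have [d d0 gd] := cg _ Ix _ (divr_gt0 e0 c0); exists d => // y Iy xy.
rewrite -mulrBr normrM; have := gd _ Iy xy; rewrite ltr_pdivlMr//.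
by apply: le_lt_trans; rewrite mulrC ler_wpM2l//; lra.
Qed.

Lemma cont11_cst c : cont11 (fun=> c).
Proof. by apply: (@lip11_cont _ 0) => x y _ _; rewrite subrr normr0 mul0r. Qed.

Lemma cont11_id : cont11 id.
Proof. by apply: (@lip11_cont _ 1) => x y _ _; rewrite mul1r. Qed.

Lemma cont11_N g : cont11 g -> cont11 (fun x => g (- x)).
Proof.
move=> cg; apply: cont11_comp => //; last exact: I11N.
by apply: (@lip11_cont _ 1) => x y _ _; rewrite -opprD normrN mul1r.
Qed.

Definition ig g := (@lebesgue_measure R).-integrable (@I11 R) (EFin \o g).

Lemma mI11 : measurable (@I11 R : set (measurableTypeR R)).
Proof. exact: measurable_itv. Qed.

Lemma measI11 : lebesgue_measure (@I11 R) = 2%:E.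
Proof.
rewrite /I11 lebesgue_measure_itv /= lte_fin (_ : -1 < 1)%R ; last by lra.
by rewrite -EFinD; congr EFin; ring.
Qed.

Lemma cont11_ig g : cont11 g -> ig g.
Proof.
by move=> /cont11P cg; apply: continuous_compact_integrable => //; exact: segment_compact.
Qed.

Lemma igD g k : ig g -> ig k -> ig (fun x => g x + k x).
Proof. by move=> ig_g ig_k; exact: (integrableD mI11 ig_g ig_k). Qed.

Lemma igZ c g : ig g -> ig (fun x => c * g x).
Proof. by move=> ig_g; exact: (integrableZl mI11 c ig_g). Qed.

Lemma ig_indic x y : ig (\1_`[x, y]).
Proof.
apply: measurable_bounded_integrable.
- exact: mI11.
- by apply: (le_lt_trans (y := 2%:E)); [rewrite -measI11|exact: ltry].
- by apply: measurable_indic; exact: measurable_itv.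
- exists 1; split => // M M1 t _ /=; apply: le_trans (ltW M1).
  by rewrite indicE; case: (_ \in _); rewrite ?normr0 ?normr1.
Qed.

Lemma int11D g k : ig g -> ig k ->
  int11 (fun x => g x + k x) = int11 g + int11 k.
Proof. by move=> *; exact: RintegralD mI11 _ _. Qed.

Lemma int11Z c g : ig g -> int11 (fun x => c * g x) = c * int11 g.
Proof. by move=> *; exact: RintegralZl mI11 _. Qed.

Lemma int11_le g k : ig g -> ig k -> (forall x, I11 x -> g x <= k x) ->
  int11 g <= int11 k.
Proof. by move=> *; exact: le_Rintegral mI11 _ _ _. Qed.

Lemma eq_int11 g k : (forall x, I11 x -> g x = k x) -> int11 g = int11 k.
Proof. by move=> gk; apply: eq_Rintegral => x /set_mem; exact: gk. Qed.

Lemma int11_cst c : int11 (fun=> c) = 2 * c.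
Proof.
transitivity (c * fine (lebesgue_measure (@I11 R))).
  exact: (Rintegral_cst _ mI11).
by rewrite measI11 mulrC.
Qed.

Lemma int11_indic x y : -1 <= x -> x <= y -> y <= 1 -> int11 (\1_`[x, y]) = y - x.
Proof.
move=> x1 xy y1; rewrite /int11 integral_indic //; last exact: mI11.
rewrite setIidl; last first.
  by move=> t /=; rewrite in_itv /= => /andP[? ?]; apply/I11P; lra.
transitivity (fine (@lebesgue_measure R [set` `[x, y]])) => //.
rewrite lebesgue_measure_itv /= lte_fin; case: ltP => //= yx.
by apply/eqP; rewrite eq_sym subr_eq0 eq_le yx.
Qed.

Lemma cont11_sum n (g : 'I_n -> R -> R) : (forall i, cont11 (g i)) ->
  cont11 (fun x => \sum_(i < n) g i x).
Proof.
elim: n g => [|n IH] g cg.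
  rewrite (_ : (fun _ => _) = fun=> 0); first exact: cont11_cst.
  by apply/funext => x; rewrite big_ord0.
rewrite (_ : (fun _ => _) = fun x => (\sum_(i < n) g (widen_ord (leqnSn n) i) x) + g ord_max x).
  by apply: cont11D => //; apply: IH => i.
by apply/funext => x; rewrite big_ord_recr.
Qed.

Lemma int11_sum n (c : 'I_n -> R) (g : 'I_n -> R -> R) : (forall i, cont11 (g i)) ->
  int11 (fun x => \sum_(i < n) c i * g i x) = \sum_(i < n) c i * int11 (g i).
Proof.
elim: n c g => [|n IH] c g cg.
  rewrite big_ord0 -[RHS](mulr0 2) -int11_cst.
  by apply: eq_int11 => x _; rewrite big_ord0.
rewrite big_ord_recr /= -IH// -int11Z; last exact: cont11_ig.
rewrite -int11D; [|apply: cont11_ig..].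
- by apply: eq_int11 => x _; rewrite big_ord_recr.
- by apply: cont11_sum => i; exact: cont11Z.
- exact: cont11Z.
Qed.

End Integration.

(** * Stieltjes integrals of ramps *)

Section Stieltjes.
Variable R : realType.
Implicit Types (f g h k Q q : R -> R) (a b c x y t : R).

(** * Monotonicity and inversion of the maps in [inG] *)

Lemma inG_cont11 f : inG f -> cont11 f.
Proof. by case=> /cont11P. Qed.

Lemma inG_I11 f x : inG f -> I11 x -> I11 (f x).
Proof. by case=> _ [fI _]; exact: fI. Qed.

Lemma inG_lt f x y : inG f -> I11 x -> I11 y -> x < y -> f x < f y.
Proof. by case=> _ [_ [fI _]]; exact: fI. Qed.

Lemma inG_le f x y : inG f -> I11 x -> I11 y -> x <= y -> f x <= f y.
Proof.
move=> Gf Ix Iy; rewrite le_eqVlt => /predU1P[->//|xy].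
exact/ltW/inG_lt.
Qed.

Lemma inG_le_mono f x y : inG f -> I11 x -> I11 y -> f x <= f y -> x <= y.
Proof.
move=> Gf Ix Iy fxy; case: (leP x y) => // yx.
by have := inG_lt Gf Iy Ix yx; lra.
Qed.

Lemma inG_intro f : cont11 f -> (forall x y, I11 x -> I11 y -> x < y -> f x < f y) ->
  f (-1) = -1 -> f 1 = 1 -> inG f.
Proof.
move=> cf flt fm1 f1; split; first exact/cont11P.
split=> [x Ix|]; last by [].
have fle u v : I11 u -> I11 v -> u <= v -> f u <= f v.
  by move=> Iu Iv; rewrite le_eqVlt => /predU1P[->//|/flt uv]; apply/ltW/uv.
have /I11P/andP[x1 x2] := Ix; apply/I11P; rewrite -{1}fm1 -{2}f1.
by rewrite !fle//; (exact: I11_1 || exact: I11_m1).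
Qed.

Lemma inG_id : inG (@id R).
Proof. by apply: inG_intro => //; exact: cont11_id. Qed.

(** The intermediate value theorem supplies a preimage, so the default 0 of [xget] is never
    returned. *)
Lemma finvP f t : inG f -> I11 t -> I11 (finv f t) /\ f (finv f t) = t.
Proof.
move=> Gf /I11P It; case: (Gf) => cf [_ [_ [fm1 f1]]].
have le11 : -1 <= 1 :> R by lra.
have [|x xI fx] := @IVT R f (-1) 1 t le11 cf.
  by rewrite fm1 f1 ge_min le_max; case/andP: It => -> ->; rewrite orbT.
exact: (@xgetPex _ 0 [set x | I11 x /\ f x = t] (ex_intro _ x (conj xI fx))).
Qed.

Lemma finv_I11 f t : inG f -> I11 t -> I11 (finv f t).
Proof. by move=> Gf It; case: (finvP Gf It). Qed.

Lemma finvK f t : inG f -> I11 t -> f (finv f t) = t.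
Proof. by move=> Gf It; case: (finvP Gf It). Qed.

Lemma finv_le f x t : inG f -> I11 x -> I11 t -> (finv f t <= x) = (t <= f x).
Proof.
move=> Gf Ix It; have Ifv := finv_I11 Gf It; apply/idP/idP => le.
- by rewrite -(finvK Gf It); apply: inG_le.
- by apply: (inG_le_mono Gf) => //; rewrite finvK.
Qed.

(** Turns the superlevel sets of [finv f] into intervals ending at 1, whose lengths are explicit. *)
Lemma finv_ge f x t : inG f -> I11 x -> I11 t -> (x <= finv f t) = (f x <= t).
Proof.
move=> Gf Ix It; have Ifv := finv_I11 Gf It; apply/idP/idP => le.
- by rewrite -(finvK Gf It); apply: inG_le.
- by apply: (inG_le_mono Gf) => //; rewrite finvK.
Qed.

Lemma finv_fK f x : inG f -> I11 x -> finv f (f x) = x.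
Proof.
move=> Gf Ix; have Ifx := inG_I11 Gf Ix; apply/le_anti.
by rewrite finv_le// lexx /= (inG_le_mono Gf)// ?finvK//; exact: finv_I11.
Qed.

Lemma finv_id t : I11 t -> finv id t = t.
Proof. exact: (finv_fK inG_id). Qed.

(** An increasing map of a segment onto a segment has no jumps. *)
Lemma finv_cont11 f : inG f -> cont11 (finv f).
Proof.
move=> Gf; case: (Gf) => _ [_ [_ [fm1 f1]]]; apply/cont11P.
have Im1 := @I11_m1 R; have I1 := @I11_1 R.
have e1 : finv f 1 = 1 by rewrite -{1}f1 finv_fK.
have em1 : finv f (-1) = -1 by rewrite -{1}fm1 finv_fK.
apply: segment_inc_surj_continuous => [s t Is It|x].
  by rewrite finv_le// ?finvK//; exact: finv_I11.
rewrite em1 e1 => Ix; exists (f x); first exact: inG_I11.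
exact: finv_fK.
Qed.

(* The Stieltjes integral of [g] against [df], after the substitution [t = f x]. *)
Definition dint f g := int11 (fun t => g (finv f t)).

Lemma dint_cont f g : inG f -> cont11 g -> cont11 (fun t => g (finv f t)).
Proof.
by move=> Gf cg; apply: cont11_comp => //; [exact: finv_cont11|move=> x; exact: finv_I11].
Qed.

Lemma dintD f g k : inG f -> cont11 g -> cont11 k ->
  dint f (fun x => g x + k x) = dint f g + dint f k.
Proof. by move=> Gf cg ck; apply: int11D; apply/cont11_ig/dint_cont. Qed.

Lemma dintZ f c g : inG f -> cont11 g -> dint f (fun x => c * g x) = c * dint f g.
Proof. by move=> Gf cg; apply: int11Z; apply/cont11_ig/dint_cont. Qed.

Lemma dint_sum f n (c : 'I_n -> R) (g : 'I_n -> R -> R) : inG f ->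
  (forall i, cont11 (g i)) ->
  dint f (fun x => \sum_(i < n) c i * g i x) = \sum_(i < n) c i * dint f (g i).
Proof.
move=> Gf cg.
exact: (@int11_sum R n c (fun i t => g i (finv f t)) (fun i => dint_cont Gf (cg i))).
Qed.

Lemma eq_dint f g k : inG f -> (forall x, I11 x -> g x = k x) -> dint f g = dint f k.
Proof. by move=> Gf gk; apply: eq_int11 => t It; apply/gk/finv_I11. Qed.

Lemma dint_cst f c : dint f (fun=> c) = 2 * c.
Proof. exact: int11_cst. Qed.

Lemma dint_id g : dint id g = int11 g.
Proof. by apply: eq_int11 => t It; rewrite finv_id. Qed.

(** * Ramps and a derivative calculus on [-1,1] *)

Definition ramp a x := Num.max (x - a) 0.

Lemma ramp_lip a : lip11 (ramp a) 1.
Proof.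
move=> x y _ _; rewrite mul1r /ramp ler_norml.
have H1 := ler_norm (x - y); have := ler_norm (- (x - y)); rewrite normrN => H2.
have H3 := normr_ge0 (x - y).
by case: (leP (x - a) 0); case: (leP (y - a) 0) => ? ?; apply/andP; split; lra.
Qed.

Lemma ramp_cont a : cont11 (ramp a).
Proof. exact: lip11_cont (ramp_lip a). Qed.

(* [derl Q q] says that [Q' = - q] on [-1,1], with a modulus that is an
   increment of a continuous function [S]. *)
Definition derl Q q := exists2 S, cont11 S & forall a b x, I11 a -> I11 b ->
  a <= x -> x <= b -> `|Q a - Q b - (b - a) * q x| <= (b - a) * (S b - S a).

Lemma derlD Q q P p : derl Q q -> derl P p ->
  derl (fun x => Q x + P x) (fun x => q x + p x).
Proof.
move=> [S cS QS] [T cT PT]; exists (fun x => S x + T x); first exact: cont11D.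
move=> a b x Ia Ib ax xb.
rewrite [X in `|X|](_ : _ = (Q a - Q b - (b - a) * q x) + (P a - P b - (b - a) * p x)); last by ring.
apply: le_trans (ler_normD _ _) _.
by have := QS _ _ _ Ia Ib ax xb; have := PT _ _ _ Ia Ib ax xb; lra.
Qed.

Lemma derlZ c Q q : derl Q q -> derl (fun x => c * Q x) (fun x => c * q x).
Proof.
move=> [S cS QS]; exists (fun x => `|c| * S x); first exact: cont11Z.
move=> a b x Ia Ib ax xb.
rewrite [X in `|X|](_ : _ = c * (Q a - Q b - (b - a) * q x)); last by ring.
rewrite normrM -mulrBr mulrCA ler_wpM2l//; exact: QS.
Qed.

Lemma derlN Q q : derl Q q -> derl (fun x => Q (- x)) (fun x => - q (- x)).
Proof.
(* Reflection swaps the endpoints of an interval; the sign change of [S] keeps the modulus an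
   increment taken in the right order. *)
move=> [S cS QS]; exists (fun x => -1 * S (- x)); first exact/cont11Z/cont11_N.
move=> a b x /I11N Ia /I11N Ib ax xb.
have := QS (- b) (- a) (- x) Ib Ia; rewrite !lerN2 => /(_ xb ax).
rewrite -normrN (_ : - a - - b = b - a); last by ring.
rewrite (_ : - (_ - _) = Q (- a) - Q (- b) - (b - a) * - q (- x)); last by ring.
by move=> /le_trans; apply; rewrite le_eqVlt; apply/orP; left; apply/eqP; ring.
Qed.

Lemma derl_affine c d : derl (fun x => c * x + d) (fun=> - c).
Proof.
exists (fun=> 0); first exact: cont11_cst.
by move=> a b x _ _ _ _; rewrite (_ : _ - _ = 0) ?normr0; [rewrite subrr mulr0|ring].
Qed.

Lemma eq_derl Q q P p : (forall x, I11 x -> Q x = P x) -> (forall x, I11 x -> q x = p x) ->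
  derl Q q -> derl P p.
Proof.
move=> QP qp [S cS QS]; exists S => // a b x Ia Ib ax xb.
rewrite -!QP// -qp; first exact: QS.
by move: Ia Ib => /I11P Ia /I11P Ib; apply/I11P; lra.
Qed.

Lemma derl_sum n (c : 'I_n -> R) (Q q : 'I_n -> R -> R) : (forall i, derl (Q i) (q i)) ->
  derl (fun x => \sum_(i < n) c i * Q i x) (fun x => \sum_(i < n) c i * q i x).
Proof.
elim: n c Q q => [|n IH] c Q q Qq.
  apply: eq_derl (derl_affine 0 0) => x _; rewrite big_ord0; by ring.
pose w (i : 'I_n) := widen_ord (leqnSn n) i.
have := derlD (IH (c \o w) (Q \o w) (q \o w) (fun i => Qq (w i)))
   (derlZ (c ord_max) (Qq ord_max)).
by apply: eq_derl => x _; rewrite big_ord_recr.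
Qed.

(** With [Q] zero, dividing the estimate by [b - a] bounds [q x] by an increment of the continuous
    [S] over any interval containing [x], and that interval can shrink to [x]. *)
Lemma derl0 Q q : derl Q q -> (forall x, I11 x -> Q x = 0) -> forall x, I11 x -> q x = 0.
Proof.
move=> [S cS QS] Q0 x Ix; apply/eqP; rewrite -normr_eq0 eq_le normr_ge0 andbT.
apply/ler_addgt0Pr => e e0; rewrite add0r.
have [d d0 Sd] := cS _ Ix _ e0.
have mod a b : I11 a -> I11 b -> a <= x -> x <= b -> a < b -> `|q x| <= S b - S a.
  move=> Ia Ib ax xb ab; have := QS _ _ _ Ia Ib ax xb.
  rewrite !Q0// subrr sub0r normrN normrM gtr0_norm ?subr_gt0//.
  by rewrite ler_pM2l// subr_gt0.
have /I11P Ix' := Ix.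
(* The intervals lie to the right of [x], except at [x = 1], where only those on the left stay in
   [-1,1]. *)
case: (ltP x 1) => x1.
- pose b := Num.min 1 (x + d / 2).
  have xb : x < b by rewrite lt_min x1 /=; lra.
  have Ib : I11 b by apply/I11P; rewrite ge_min lexx andbT; lra.
  apply: le_trans (mod _ _ Ix Ib (lexx _) (ltW xb) xb) _.
  have bd : b <= x + d / 2 by rewrite ge_min lexx orbT.
  have : `|x - b| < d by rewrite ltr_norml; apply/andP; split; lra.
  by move/(Sd _ Ib); rewrite ltr_norml => /andP[]; lra.
- pose b := Num.max (-1) (x - d / 2).
  have xb : b < x by rewrite gt_max; apply/andP; split; lra.
  have Ib : I11 b by apply/I11P; rewrite le_max lexx /=; lra.
  apply: le_trans (mod _ _ Ib Ix (ltW xb) (lexx _) xb) _.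
  have bd : x - d / 2 <= b by rewrite le_max lexx orbT.
  have : `|x - b| < d by rewrite ltr_norml; apply/andP; split; lra.
  by move/(Sd _ Ib); rewrite ltr_norml => /andP[]; lra.
Qed.

(** Cut [-1,1] into [N.+1] equal pieces: the increments of [S] telescope, so the total error is
    [2 / N.+1] times [S 1 - S (-1)], which tends to 0. *)
Lemma derl_const Q : derl Q (fun=> 0) -> Q (-1) = Q 1.
Proof.
move=> [S cS QS]; apply/eqP; rewrite -subr_eq0 -normr_eq0 eq_le normr_ge0 andbT.
have step (N k : nat) : (k <= N.+1)%N ->
    `|Q (-1) - Q (-1 + 2 * k%:R / N.+1%:R)| <=
    2 / N.+1%:R * (S (-1 + 2 * k%:R / N.+1%:R) - S (-1)).
  have N0 : 0 < N.+1%:R :> R by rewrite ltr0n.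
  elim: k => [_|k IH kN]; first by rewrite mulr0 mul0r addr0 !subrr normr0 mulr0.
  pose u : R := -1 + 2 * k%:R / N.+1%:R; set v := -1 + 2 * k.+1%:R / N.+1%:R.
  have uv : v - u = 2 / N.+1%:R by rewrite /u /v -[k.+1]addn1 natrD; field; lra.
  have kN' : k.+1%:R / N.+1%:R <= 1 :> R by rewrite ler_pdivrMr// mul1r ler_nat.
  have k0 : 0 <= k%:R / N.+1%:R :> R by rewrite divr_ge0.
  have k1 : k%:R / N.+1%:R <= k.+1%:R / N.+1%:R :> R by rewrite ler_pM2r ?invr_gt0// ler_nat.
  have vE : v = -1 + 2 * (k.+1%:R / N.+1%:R) by rewrite mulrA.
  have uE : u = -1 + 2 * (k%:R / N.+1%:R) by rewrite mulrA.
  have [uv' [Iu Iv]] : u <= v /\ I11 u /\ I11 v.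
    rewrite uE vE; move: (k%:R / _) (k.+1%:R / _) kN' k0 k1 => p r r1 p0 pr.
    by split; [|split; apply/I11P]; lra.
  have := QS _ _ _ Iu Iv (lexx u) uv'; rewrite mulr0 subr0 uv => H.
  rewrite (_ : _ - _ = (Q (-1) - Q u) + (Q u - Q v)); last by ring.
  apply: le_trans (ler_normD _ _) _; have := IH (ltnW kN); rewrite -/u.
  by move: (2 / _) H => w; lra.
have H N : `|Q (-1) - Q 1| <= (2 * (S 1 - S (-1))) / N.+1%:R.
  have := step N N.+1 (leqnn _); rewrite mulfK ?pnatr_eq0//.
  rewrite (_ : -1 + 2 = 1 :> R); last by ring.
  by move=> /le_trans; apply; rewrite mulrAC.
case: (leP `|Q (-1) - Q 1| 0) => // D0.
set C := 2 * _ in H; have C0 : 0 < `|C| + 1 by have := normr_ge0 C; lra.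
have [N] := ltr_add_invr (divr_gt0 D0 C0); rewrite add0r ltr_pdivlMr// => HN.
have w0 : 0 <= N.+1%:R^-1 :> R by rewrite invr_ge0.
have := H N; move: (N.+1%:R^-1) HN w0 => w HN w0.
by have := ler_wpM2r w0 (ler_norm C); lra.
Qed.

(** For [a <= b], [ramp a - ramp b] lies between [b - a] times the indicators of [b,1] and of [a,1].
    Composed with [finv f], these become the indicators of [f b,1] and [f a,1], so [f] itself serves
    as modulus. *)
Lemma ramp_derl f : inG f -> derl (fun a => dint f (ramp a)) (fun x => 1 - f x).
Proof.
move=> Gf; exists f; first exact: inG_cont11.
have f1 : f 1 = 1 by case: Gf => _ [_ [_ []]].
move=> a b x Ia Ib ax xb; have ab := le_trans ax xb.
have Ix : I11 x by move: Ia Ib => /I11P Ia /I11P Ib; apply/I11P; lra.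
have igr c : ig (fun t => ramp c (finv f t)).
  by apply/cont11_ig/dint_cont => //; exact: ramp_cont.
have diff : dint f (ramp a) - dint f (ramp b) =
    int11 (fun t => ramp a (finv f t) + (-1) * ramp b (finv f t)).
  by rewrite int11D ?int11Z ?mulN1r//; exact: igZ.
have igd : ig (fun t => ramp a (finv f t) + (-1) * ramp b (finv f t)).
  by apply: igD => //; exact: igZ.
have indE c : I11 c -> (b - a) * (1 - f c) = int11 (fun t => (b - a) * \1_`[f c, 1] t).
  move=> Ic; have /I11P/andP[? ?] := inG_I11 Gf Ic.
  by rewrite int11Z ?int11_indic//; exact: ig_indic.
have igi c : ig (fun t => (b - a) * \1_`[f c, 1] t) by apply/igZ/ig_indic.
have low : (b - a) * (1 - f b) <= dint f (ramp a) - dint f (ramp b).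
  rewrite diff indE//; apply: int11_le => // t It; rewrite indicE mem_setE in_itv /=.
  have It' := It; move: It' => /I11P/andP[_ ->]; rewrite andbT /ramp.
  rewrite -(finv_ge Gf Ib It).
  by case: (leP b (finv f t)) => /=; case: (leP (finv f t - a) 0); case: (leP (finv f t - b) 0); lra.
have upp : dint f (ramp a) - dint f (ramp b) <= (b - a) * (1 - f a).
  rewrite diff indE//; apply: int11_le => // t It; rewrite indicE mem_setE in_itv /=.
  have It' := It; move: It' => /I11P/andP[_ ->]; rewrite andbT /ramp.
  rewrite -(finv_ge Gf Ia It).
  by case: (leP a (finv f t)) => /=; case: (leP (finv f t - a) 0); case: (leP (finv f t - b) 0); lra.
have fa := inG_le Gf Ia Ix ax; have fb := inG_le Gf Ix Ib xb.
have ba : 0 <= b - a by lra.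
rewrite ler_norml; apply/andP; split.
- by have := ler_wpM2l ba fa; lra.
- by have := ler_wpM2l ba fb; lra.
Qed.

(** The function of [a] is the integral of [f] over [a,1], written with integrals over all of
    [-1,1]: [f (Num.max t a)] equals [f a] on [-1,a], which contributes [(a + 1) * f a]. *)
Lemma dint_derl_id f : inG f ->
  derl (fun a => int11 (fun t => f (Num.max t a)) - (a + 1) * f a) f.
Proof.
move=> Gf; exists f; first exact: inG_cont11.
move=> a b x Ia Ib ax xb; have ab := le_trans ax xb.
have Ix : I11 x by move: Ia Ib => /I11P Ia /I11P Ib; apply/I11P; lra.
have fab := inG_le Gf Ia Ib ab.
have Imax c t : I11 c -> I11 t -> I11 (Num.max t c) by case: (leP t c).
have igm c : I11 c -> ig (fun t => f (Num.max t c)).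
  move=> Ic; apply/cont11_ig/cont11_comp; first exact: inG_cont11; last by move=> t; exact: Imax.
  apply: (@lip11_cont _ _ 1) => s t _ _; rewrite mul1r ler_norml.
  have H1 := ler_norm (s - t); have := ler_norm (- (s - t)); rewrite normrN => H2.
  have H3 := normr_ge0 (s - t).
  by case: (leP s c); case: (leP t c) => ? ?; apply/andP; split; lra.
have igc c : ig (fun t => (f b - f a) * \1_`[-1, c] t) by apply/igZ/ig_indic.
have intc c : I11 c -> int11 (fun t => (f b - f a) * \1_`[-1, c] t) = (f b - f a) * (c + 1).
  by move=> /I11P/andP[? ?]; rewrite int11Z ?int11_indic ?opprK//; exact: ig_indic.
have low : int11 (fun t => f (Num.max t a)) + (f b - f a) * (a + 1) <=
    int11 (fun t => f (Num.max t b)).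
  rewrite -(intc a)// -int11D ?igm//; apply: int11_le; [by apply: igD; rewrite ?igm|exact: igm|].
  move=> t It; rewrite indicE mem_setE in_itv /=; have /I11P/andP[-> _] /= := It.
  case: (leP t a) => ta /=; first by rewrite mulr1; case: (leP t b); lra.
  rewrite mulr0 addr0; case: (leP t b) => // tb; exact: inG_le.
have upp : int11 (fun t => f (Num.max t b)) <=
    int11 (fun t => f (Num.max t a)) + (f b - f a) * (b + 1).
  rewrite -(intc b)// -int11D ?igm//; apply: int11_le; [exact: igm|by apply: igD; rewrite ?igm|].
  move=> t It; rewrite indicE mem_setE in_itv /=; have /I11P/andP[-> _] /= := It.
  case: (leP t b) => tb /=; last by case: (leP t a); lra.
  case: (leP t a) => ta; first by lra.
  by have := inG_le Gf Ia It (ltW ta); lra.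
have fa := inG_le Gf Ia Ix ax; have fb := inG_le Gf Ix Ib xb.
have ba : 0 <= b - a by lra.
rewrite ler_norml; apply/andP; split.
- by have := ler_wpM2l ba fb; lra.
- by have := ler_wpM2l ba fa; lra.
Qed.

(* Integration by parts: both sides of [dint f (ramp a) = \int_a^1 (1 - f)] have
   the same derivative in [a] and vanish at [a = 1]. *)
Lemma int11_finv f : inG f -> int11 (finv f) = - int11 f.
Proof.
move=> Gf; have f1 : f 1 = 1 by case: Gf => _ [_ [_ []]].
have q0 x : I11 x -> (1 - f x) + f x + (- 1) = 0 by move=> _; ring.
have := derl_const (eq_derl (fun _ _ => erefl) q0
  (derlD (derlD (ramp_derl Gf) (dint_derl_id Gf)) (derl_affine 1 0))).
have -> : dint f (ramp (-1)) = int11 (finv f) + 2.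
  rewrite -[2]mulr1 -(int11_cst 1) -int11D; [|apply: cont11_ig..].
  - apply: eq_int11 => t It; rewrite /ramp opprK max_l//.
    by have /I11P := finv_I11 Gf It; lra.
  - exact: finv_cont11.
  - exact: cont11_cst.
have -> : dint f (ramp 1) = 0.
  rewrite -[RHS](mulr0 2) -int11_cst; apply: eq_int11 => t It; rewrite /ramp max_r//.
  by have /I11P := finv_I11 Gf It; lra.
have -> : int11 (fun t => f (Num.max t (-1))) = int11 f.
  by apply: eq_int11 => t /I11P It; rewrite max_l//; lra.
have -> : int11 (fun t => f (Num.max t 1)) = 2.
  rewrite -[RHS]mulr1 -int11_cst; apply: eq_int11 => t /I11P It.
  by rewrite max_r//; lra.
by rewrite f1; lra.
Qed.

Lemma dint_idr f : inG0 f -> dint f id = 0.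
Proof. by case=> Gf f0; rewrite /dint int11_finv// f0 oppr0. Qed.

(** Twice the odd part of [ramp a], so that combinations can perturb the identity among odd maps. *)
Definition oramp a x := ramp a x - ramp a (- x).

Lemma oramp_lip a : lip11 (oramp a) 2.
Proof.
move=> x y Ix Iy; rewrite /oramp.
have := ramp_lip a Ix Iy; have := ramp_lip a (I11N Ix) (I11N Iy).
rewrite -opprD normrN !mul1r => H1 H2.
rewrite (_ : _ - _ = (ramp a x - ramp a y) - (ramp a (- x) - ramp a (- y))); last by ring.
by apply: le_trans (ler_normB _ _) _; lra.
Qed.

(** From [ramp a (- x) = ramp (- a) x - (x + a)], [oramp a] is [ramp a - ramp (- a)] plus [x + a].
    As [dint f id] is 0, the constants in the derivative cancel and only the even part of [f]
    survives. *)
Lemma oramp_derl f : inG0 f ->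
  derl (fun a => dint f (oramp a)) (fun x => -2 * even_part f x).
Proof.
move=> G0f; have [Gf f0] := G0f.
apply: eq_derl (derlD (derlD (ramp_derl Gf) (derlZ (-1) (derlN (ramp_derl Gf)))) (derl_affine 2 0)).
- move=> a Ia; transitivity (dint f (fun x => ramp a x + (-1 * ramp (- a) x + (x + a)))).
    rewrite !dintD ?dintZ ?dint_idr ?dint_cst//; first by ring.
    all: repeat first [exact: ramp_cont|exact: cont11_id|exact: cont11_cst|apply: cont11D|apply: cont11Z].
  apply: eq_dint => // x _; rewrite /oramp /ramp.
  by case: (leP (x - a) 0); case: (leP (- x - a) 0); case: (leP (x - - a) 0); lra.
- by move=> x _; rewrite /even_part; field.
Qed.

End Stieltjes.

(** * Detecting linear relations at finitely many points *)

Section Sampling.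
Variables (F : fieldType) (T : Type) (X : set T) (N : nat) (psi : 'I_N -> T -> F).

Definition sample m (x : 'I_m -> T) : 'M[F]_(N, m) := \matrix_(i, k) psi i (x k).

(* A sample whose left kernel has minimal rank detects every relation. *)
Lemma sample_determining : exists m (x : 'I_m -> T), (forall k, X (x k)) /\
  forall c : 'rV[F]_N, c *m sample x = 0 ->
    forall t, X t -> \sum_i c 0 i * psi i t = 0.
Proof.
suff H r m (x : 'I_m -> T) : (forall k, X (x k)) -> (\rank (kermx (sample x)) <= r)%N ->
    exists m (x : 'I_m -> T), (forall k, X (x k)) /\
    forall c : 'rV[F]_N, c *m sample x = 0 ->
      forall t, X t -> \sum_i c 0 i * psi i t = 0.
  by apply: (H _ 0%N (fun k : 'I_0 => match notF (ltn_ord k) with end)) (leqnn _); case.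
elim: r m x => [|r IH] m x Xx rk.
  exists m, x; split=> // c cx t _.
  move: rk; rewrite leqn0 mxrank_eq0 => /eqP ker0.
  have /sub_kermxP : c *m sample x = 0 by [].
  rewrite ker0 submx0 => /eqP ->; rewrite big1// => i _; by rewrite mxE mul0r.
have [?|] := pselect (forall c : 'rV[F]_N, c *m sample x = 0 ->
      forall t, X t -> \sum_i c 0 i * psi i t = 0); first by exists m, x.
move=> /existsNP[c] /not_implyP[cx] /existsNP[t] /not_implyP[Xt] /eqP ct.
(* The relation [c] holds on the sample but fails at [t]: adding [t] as a sample point removes [c]
   from the kernel and strictly lowers its rank. *)
pose y (k : 'I_(m + 1)) := if fintype.split k is inl j then x j else t.
have sE : sample y = row_mx (sample x) (\col_i psi i t).
  apply/matrixP => i k; rewrite !mxE /y; case: splitP => j _; by rewrite !mxE.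
apply: (IH _ y) => [k|]; first by rewrite /y; case: splitP.
rewrite -ltnS; apply: leq_trans rk; apply: rank_ltmx.
rewrite ltmxE; apply/andP; split.
  apply/sub_kermxP; have /eqP := mulmx_ker (sample y).
  by rewrite sE mul_mx_row row_mx_eq0 => /andP[/eqP].
apply/negP => sub; have : (c <= kermx (sample y))%MS.
  by apply: submx_trans sub; apply/sub_kermxP.
move/sub_kermxP/eqP; rewrite sE mul_mx_row row_mx_eq0 => /andP[_ /eqP].
move/matrixP/(_ 0 0); rewrite !mxE => c0; case/eqP: ct; apply: etrans c0.
by apply: eq_bigr => i _; rewrite mxE.
Qed.

(** Independence makes the rows of a determining sample matrix free; column [j] of a right inverse
    then holds the weights. *)
Lemma dual_weights : (forall c : 'I_N -> F, (forall t, X t -> \sum_i c i * psi i t = 0) ->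
    forall i, c i = 0) ->
  forall j, exists m (x : 'I_m -> T) (u : 'I_m -> F), (forall k, X (x k)) /\
    forall i, \sum_k u k * psi i (x k) = (i == j)%:R.
Proof.
move=> indep j; have [m [x [Xx det]]] := sample_determining.
have free : row_free (sample x).
  rewrite -kermx_eq0; apply/eqP/row_matrixP => i; rewrite row0.
  apply/rowP => l; rewrite [RHS]mxE.
  apply: (indep (fun l => row i (kermx (sample x)) 0 l)); apply: det.
  by rewrite -row_mul mulmx_ker row0.
exists m, x, (fun k => pinvmx (sample x) k j); split=> // i.
have /matrixP/(_ i j) := mulmxVp free; rewrite !mxE => <-.
by apply: eq_bigr => k _; rewrite mulrC [in RHS]mxE.
Qed.

End Sampling.

(** * Test functions *)

Section TestFunctions.
Variable R : realType.
Implicit Types (f g h : R -> R) (b c x y t : R).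

Lemma lip11Z c g K : lip11 g K -> lip11 (fun x => c * g x) (`|c| * K).
Proof.
by move=> gK x y Ix Iy; rewrite -mulrBr normrM -mulrA ler_wpM2l//; exact: gK.
Qed.

Lemma lip11_sum n (c : 'I_n -> R) (g : 'I_n -> R -> R) (K : 'I_n -> R) :
  (forall i, lip11 (g i) (K i)) ->
  lip11 (fun x => \sum_i c i * g i x) (\sum_i `|c i| * K i).
Proof.
move=> gK x y Ix Iy; rewrite -sumrB mulr_suml.
apply: le_trans (ler_norm_sum _ _ _) _; apply: ler_sum => i _.
exact: (lip11Z (c i) (gK i)).
Qed.

Lemma lip11_exp n : lip11 (fun x : R => x ^+ n) n%:R.
Proof.
elim: n => [|n IH] x y Ix Iy; first by rewrite !expr0 subrr normr0 mul0r.
rewrite (_ : _ - _ = x * (x ^+ n - y ^+ n) + (x - y) * y ^+ n); last by rewrite !exprS; ring.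
have n1 (z : R) : I11 z -> `|z| <= 1 by move=> /I11P; rewrite ler_norml.
apply: le_trans (ler_normD _ _) _; rewrite !normrM normrX.
have := IH _ _ Ix Iy; have := ler_wpM2r (normr_ge0 (x ^+ n - y ^+ n)) (n1 _ Ix).
have := ler_wpM2l (normr_ge0 (x - y)) (exprn_ile1 n (normr_ge0 y) (n1 _ Iy)).
by rewrite -[n.+1]addn1 natrD; lra.
Qed.

(* Finite combinations of the kernels [rho a], vanishing at [1], separate the
   functionals [dint (F i)] as soon as no relation holds between their values on
   the kernels and the values [1 - a] of the kernels at [1]. *)
Lemma dual_test (rho : R -> R -> R) K n (F : 'I_n -> R -> R) :
  (forall a, I11 a -> lip11 (rho a) K) -> (forall a, I11 a -> rho a 1 = 1 - a) ->
  (forall i, inG (F i)) ->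
  (forall b (c : 'I_n -> R),
    (forall a, I11 a -> b * (1 - a) + \sum_i c i * dint (F i) (rho a) = 0) ->
    b = 0 /\ forall i, c i = 0) ->
  forall j, exists m (a : 'I_m -> R) (u : 'I_m -> R) L,
    let h x := \sum_k u k * rho (a k) x in
    [/\ forall k, I11 (a k), lip11 h L, h 1 = 0 & forall i, dint (F i) h = (i == j)%:R].
Proof.
move=> rhoK rho1 GF indep j.
(* The value at 1 is adjoined as coordinate [ord0]: weights dual to [lift ord0 j] annihilate it,
   which gives [h 1 = 0]. *)
pose psi (i : 'I_n.+1) a := if unlift ord0 i is Some l then dint (F l) (rho a) else 1 - a.
have psi0 a : psi ord0 a = 1 - a by rewrite /psi unlift_none.
have psiS l a : psi (lift ord0 l) a = dint (F l) (rho a) by rewrite /psi liftK.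
have [|m [a [u [Ia dual]]]] := @dual_weights R R (@I11 R) n.+1 psi _ (lift ord0 j).
  move=> c cpsi; have [|c0 cS] := indep (c ord0) (fun l => c (lift ord0 l)).
    move=> a /cpsi; rewrite big_ord_recl psi0 => H; rewrite -[RHS]H; congr (_ + _).
    by apply: eq_bigr => l _; rewrite psiS.
  by move=> i; case: (unliftP ord0 i) => [l ->|->].
exists m, a, u, (\sum_k `|u k| * K); split => //.
- by apply: lip11_sum => k; exact: rhoK.
- by rewrite -[RHS](dual ord0); apply: eq_bigr => k _; rewrite psi0 rho1.
- move=> i; rewrite dint_sum//; last by move=> k; exact: lip11_cont (rhoK _ (Ia k)).
  rewrite (_ : (i == j) = (lift ord0 i == lift ord0 j)) -?dual.
    by apply: eq_bigr => k _; rewrite psiS.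
  by rewrite (inj_eq lift_inj).
Qed.

(** Differentiating a relation in [a] gives [b + \sum_i c i * (1 - F i x) = 0]. At 1 this yields
    [b = 0], at -1 that the [c i] sum to 0, and a linear relation between the [F i] remains. *)
Lemma ramp_test n (F : 'I_n -> R -> R) : (forall i, inG0 (F i)) -> lin_indep F ->
  forall j, exists h L, [/\ lip11 h L, h (-1) = 0, h 1 = 0 &
    forall i, dint (F i) h = (i == j)%:R].
Proof.
move=> G0F indep j; have GF i : inG (F i) by case: (G0F i).
have [||m [a [u [L [Ia hL h1 hF]]]]] :=
  @dual_test (@ramp R) 1 n F (fun a _ => @ramp_lip R a) _ GF _ j.
- by move=> a /I11P Ia; rewrite /ramp max_l//; lra.
- move=> b c Hbc.
  have d0 := derl0 (derlD (derlZ b (derl_affine (-1) 1))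
                          (derl_sum c (fun i => ramp_derl (GF i)))).
  have {}d0 x : I11 x -> b + \sum_i c i * (1 - F i x) = 0.
    move=> Ix; have := d0 _ x Ix; rewrite opprK mulr1; apply => a Ia.
    by rewrite -[RHS](Hbc a Ia); congr (_ * _ + _); ring.
  have b0 : b = 0.
    have := d0 1 (@I11_1 R); rewrite big1 ?addr0// => i _.
    by case: (GF i) => _ [_ [_ [_ ->]]]; rewrite subrr mulr0.
  split=> //; apply: indep => x Ix.
  have sc : \sum_i c i = 0.
    have := d0 (-1) (@I11_m1 R); rewrite b0 add0r.
    have Fm1 i : c i * (1 - F i (-1)) = 2 * c i.
      by case: (GF i) => _ [_ [_ [-> _]]]; ring.
    under eq_bigr do rewrite Fm1.
    by rewrite -mulr_sumr => /eqP; rewrite mulf_eq0 pnatr_eq0 /= => /eqP.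
  have := d0 x Ix; rewrite b0 add0r; under eq_bigr do rewrite mulrBr mulr1.
  by rewrite sumrB sc sub0r => /eqP; rewrite oppr_eq0 => /eqP.
exists (fun x => \sum_k u k * ramp (a k) x), L; split=> //.
rewrite big1// => k _; rewrite /ramp max_r ?mulr0//.
by have /I11P := Ia k; lra.
Qed.

(** Differentiation now leaves [b] plus a combination of even parts. These vanish at 1, so [b = 0],
    and independence of the even parts concludes. *)
Lemma oramp_test n (F : 'I_n -> R -> R) : (forall i, inG0 (F i)) ->
  lin_indep (fun i => even_part (F i)) ->
  forall j, exists h L, [/\ lip11 h L, (forall x, h (- x) = - h x), h 1 = 0 &
    forall i, dint (F i) h = (i == j)%:R].
Proof.
move=> G0F indep j; have GF i : inG (F i) by case: (G0F i).
have [||m [a [u [L [Ia hL h1 hF]]]]] :=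
  @dual_test (@oramp R) 2 n F (fun a _ => @oramp_lip R a) _ GF _ j.
- move=> a /I11P Ia; rewrite /oramp /ramp max_l ?max_r ?subr0//; lra.
- move=> b c Hbc.
  have d0 := derl0 (derlD (derlZ b (derl_affine (-1) 1))
                          (derl_sum c (fun i => oramp_derl (G0F i)))).
  have {}d0 x : I11 x -> b + \sum_i c i * (-2 * even_part (F i) x) = 0.
    move=> Ix; have := d0 _ x Ix; rewrite opprK mulr1; apply => a Ia.
    by rewrite -[RHS](Hbc a Ia); congr (_ * _ + _); ring.
  have b0 : b = 0.
    have := d0 1 (@I11_1 R); rewrite big1 ?addr0// => i _.
    by rewrite /even_part; case: (GF i) => _ [_ [_ [-> ->]]]; ring.
  split=> //; apply: indep => x Ix; have := d0 x Ix; rewrite b0 add0r.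
  under eq_bigr do rewrite mulrCA.
  by rewrite -mulr_sumr => /eqP; rewrite mulf_eq0 oppr_eq0 pnatr_eq0 /= => /eqP.
exists (fun x => \sum_k u k * oramp (a k) x), L; split=> // x.
by rewrite -sumrN; apply: eq_bigr => k _; rewrite /oramp opprK; ring.
Qed.

(** * Even polynomials outside a given span *)

Definition inspan n (w : 'I_n -> R -> R) h :=
  exists c : 'I_n -> R, forall t, I11 t -> h t = \sum_i c i * w i t.

Lemma rVpoly_horner d (u : 'rV[R]_d) x : (rVpoly u).[x] = \sum_(k < d) u 0 k * x ^+ k.
Proof. by rewrite horner_poly; apply: eq_bigr => k _; rewrite valK. Qed.

(** The numbers [k.+1%:R^-1] for [k < size p] are distinct squares of points of [-1,1], hence too
    many roots for a nonzero [p]. *)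
Lemma poly_sqr_eq0 (p : {poly R}) : (forall x, I11 x -> p.[x ^+ 2] = 0) -> p = 0.
Proof.
move=> p0; apply/eqP/negPn/negP => pn0.
have := @max_poly_roots _ p [seq k.+1%:R^-1 | k <- iota 0 (size p)] pn0.
rewrite size_map size_iota ltnn => H; suff : false by []; apply: H.
- apply/allP => _ /mapP[k _ ->]; apply/rootP.
  have k0 : 0 <= k.+1%:R^-1 :> R by rewrite invr_ge0.
  rewrite -(sqr_sqrtr k0); apply: p0; apply/I11P.
  have := sqrtr_ge0 (k.+1%:R^-1 : R).
  have : Num.sqrt (k.+1%:R^-1 : R) <= 1.
    by rewrite -[leRHS]sqrtr1 ler_sqrt ?ler01// invf_le1 ?ltr0Sn ?ler1n.
  by lra.
- by rewrite map_inj_uniq ?iota_uniq// => k l /invr_inj/eqP; rewrite eqr_nat eqSS => /eqP.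
Qed.

(* Even polynomials meet any finite number of linear conditions; vanishing at the
   sample points of [w] forces an element of the span of [w] to be zero. *)
Lemma even_kernel m (F : 'I_m -> R -> R) p (w : 'I_p -> R -> R) : (forall i, inG (F i)) ->
  exists h L, [/\ lip11 h L, (forall x, h (- x) = h x), h 1 = 0,
    forall i, dint (F i) h = 0 & ~ inspan w h].
Proof.
move=> GF; have [s [y [Iy det]]] := @sample_determining R R (@I11 R) p w.
(* The [s] sample values, the [m] functionals and the value at 1 impose [N] conditions on [N.+1]
   coefficients, so a nonzero solution exists. *)
pose N := (s + (m + 1))%N.
pose e (k : 'I_N.+1) x : R := x ^+ (2 * k).
pose A : 'M[R]_(N.+1, s + (m + 1)) :=
  row_mx (\matrix_(k, j) e k (y j)) (row_mx (\matrix_(k, i) dint (F i) (e k)) (\col_k e k 1)).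
have /rowV0Pn[u /sub_kermxP uA u0] : kermx A != 0.
  by rewrite kermx_eq0 -row_leq_rank -ltnNge ltnS rank_leq_col.
have ce k : cont11 (e k) by exact: lip11_cont (lip11_exp (2 * k)).
move: uA => /eqP; rewrite !mul_mx_row !row_mx_eq0 => /and3P[/eqP uy /eqP uF /eqP u1].
pose h x := \sum_k u 0 k * e k x.
exists h, (\sum_k `|u 0 k| * (2 * k)%:R); split.
- by apply: lip11_sum => k; exact: lip11_exp.
- by move=> x; apply: eq_bigr => k _; rewrite /e !exprM sqrrN.
- have /matrixP/(_ 0 0) := u1; rewrite !mxE => H; rewrite -[RHS]H.
  by apply: eq_bigr => k _; rewrite mxE.
- move=> i; rewrite dint_sum//.
  have /matrixP/(_ 0 i) := uF; rewrite !mxE => H; rewrite -[RHS]H.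
  by apply: eq_bigr => k _; rewrite mxE.
- case=> c hc.
  have h0 t : I11 t -> h t = 0.
    move=> It; have cy : (\row_i c i) *m sample w y = 0.
      apply/rowP => j; rewrite !mxE.
      have /matrixP/(_ 0 j) := uy; rewrite !mxE => H; rewrite -[RHS]H.
      transitivity (h (y j)); last by apply: eq_bigr => k _; rewrite mxE.
      by rewrite hc//; apply: eq_bigr => i _; rewrite !mxE.
    rewrite hc// -[RHS](det _ cy _ It); apply: eq_bigr => i _; by rewrite mxE.
  case/eqP: u0; rewrite -[u]rVpolyK (_ : rVpoly u = 0) ?linear0//.
  apply: poly_sqr_eq0 => x Ix; rewrite rVpoly_horner -[RHS](h0 x Ix).
  by apply: eq_bigr => k _; rewrite /e exprM.
Qed.

End TestFunctions.

(** * Interior of the image *)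

Section Image.
Variable R : realType.
Implicit Types (g h : R -> R) (b c x y t : R).

Lemma interior_normP (V : normedModType R) (A : set V) (v : V) :
  A° v <-> exists2 e, 0 < e & forall w, `|w| < e -> A (v + w).
Proof.
rewrite /interior; split=> [/nbhs_normP[e /= e0 eA]|[e e0 eA]].
- by exists e => // w we; apply: eA; rewrite /= opprD addNKr normrN.
- apply/nbhs_normP; exists e => // w /= we; rewrite -[w](subrKC v).
  by apply: eA; rewrite -normrN opprB.
Qed.

(** A translate of a convex combination is the same combination of the translated points, so the
    smaller of the two radii works. *)
Lemma convex_interior (V : normedModType R) (A : set V) :
  (forall v w t, A v -> A w -> 0 <= t <= 1 -> A (t *: v + (1 - t) *: w)) ->
  convex_set A°.
Proof.
move=> cA v w t; rewrite !inE => /interior_normP[e e0 eA] /interior_normP[d d0 dA].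
apply/interior_normP; exists (Num.min e d); first by rewrite lt_min e0.
move=> z; rewrite lt_min => /andP[ze zd].
rewrite (_ : _ + z = t%:num *: (v + z) + (1 - t%:num) *: (w + z)).
  by apply: cA; [exact: eA|exact: dA|apply/andP; split].
rewrite [RHS](_ : _ = (t%:num *: v + (1 - t%:num) *: w) + z)//.
by rewrite !scalerDr addrACA -[in LHS]scalerDl subrKC scale1r.
Qed.

Lemma coord_le_norm n (v : 'rV[R]_n) j : `|v 0 j| <= `|v|.
Proof.
rewrite -[leRHS]/(mx_norm v) mx_normrE.
exact: (le_bigmax _ (fun ij => `|v ij.1 ij.2|) (0, j)).
Qed.

(** A perturbation whose Lipschitz constant is below the slope bound [s] cannot destroy strict
    monotonicity. *)
Lemma inG_perturb g h s L : inG g ->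
  (forall x y, I11 x -> I11 y -> x < y -> s * (y - x) <= g y - g x) ->
  lip11 h L -> L < s -> h (-1) = 0 -> h 1 = 0 -> inG (fun x => g x + h x).
Proof.
move=> Gg gs hL Ls hm1 h1; have [_ [_ [_ [gm1 g1]]]] := Gg; apply: inG_intro.
- by apply: cont11D; [exact: inG_cont11|exact: lip11_cont hL].
- move=> x y Ix Iy xy; have := gs _ _ Ix Iy xy.
  have := hL _ _ Ix Iy; rewrite ler_norml distrC gtr0_norm ?subr_gt0// => /andP[_].
  have : L * (y - x) < s * (y - x) by rewrite ltr_pM2r// subr_gt0.
  by lra.
- by rewrite gm1 hm1 addr0.
- by rewrite g1 h1 addr0.
Qed.

Lemma inG_conv g h t : inG g -> inG h -> 0 <= t <= 1 ->
  inG (fun x => t * g x + (1 - t) * h x).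
Proof.
move=> Gg Gh /andP[t0 t1].
have [_ [_ [_ [gm1 g1]]]] := Gg; have [_ [_ [_ [hm1 h1]]]] := Gh.
apply: inG_intro; first by apply: cont11D; apply: cont11Z; exact: inG_cont11.
- move=> x y Ix Iy xy; have gxy := inG_lt Gg Ix Iy xy; have hxy := inG_lt Gh Ix Iy xy.
  have [->|tn0] := eqVneq t 0; first by lra.
  have tp : 0 < t by rewrite lt_neqAle eq_sym tn0.
  have : t * g x < t * g y by rewrite ltr_pM2l.
  have : (1 - t) * h x <= (1 - t) * h y by apply: ler_wpM2l; lra.
  by lra.
- by rewrite gm1 hm1; ring.
- by rewrite g1 h1; ring.
Qed.

Lemma inG0_conv g h t : inG0 g -> inG0 h -> 0 <= t <= 1 ->
  inG0 (fun x => t * g x + (1 - t) * h x).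
Proof.
move=> [Gg g0] [Gh h0] t01; split; first exact: inG_conv.
have := inG_cont11 Gg; have := inG_cont11 Gh => ch cg.
by rewrite int11D ?int11Z ?g0 ?h0; [ring|apply/cont11_ig => //; exact: cont11Z..].
Qed.

Lemma inG00_conv g h t : inG00 g -> inG00 h -> 0 <= t <= 1 ->
  inG00 (fun x => t * g x + (1 - t) * h x).
Proof.
move=> [Gg go] [Gh ho] t01; split; first exact: inG_conv.
by move=> x Ix; rewrite go// ho//; ring.
Qed.

(** The identity is its own inverse, so [int11_finv] makes its integral equal to its opposite. *)
Lemma inG0_id : inG0 (@id R).
Proof.
split; first exact: inG_id.
have := int11_finv (@inG_id R); rewrite (@eq_int11 _ (finv id) id); first by lra.
exact: finv_id.
Qed.

Variables (n : nat) (f : 'I_n -> R -> R).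
Hypothesis G0f : forall i, inG0 (f i).

Let Gf i : inG (f i). Proof. by case: (G0f i). Qed.

Lemma LfE g i : Lf f g 0 i = dint (f i) g.
Proof. by rewrite mxE. Qed.

Lemma LfD g h : cont11 g -> cont11 h -> Lf f (fun x => g x + h x) = Lf f g + Lf f h.
Proof. by move=> cg ch; apply/rowP => i; rewrite [RHS]mxE !LfE dintD. Qed.

Lemma LfZ b g : cont11 g -> Lf f (fun x => b * g x) = b *: Lf f g.
Proof. by move=> cg; apply/rowP => i; rewrite [RHS]mxE !LfE dintZ. Qed.

Lemma Lf_id : Lf f id = 0.
Proof. by apply/rowP => i; rewrite LfE dint_idr// mxE. Qed.

Lemma convex_image_interior (P : set (R -> R)) : (forall g, P g -> inG g) ->
  (forall g h t, P g -> P h -> 0 <= t <= 1 -> P (fun x => t * g x + (1 - t) * h x)) ->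
  convex_set (Lf f @` P)°.
Proof.
move=> PG cP; apply: convex_interior => v w t [g Pg <-] [h Ph <-] t01.
exists (fun x => t * g x + (1 - t) * h x); first exact: cP.
have cg := inG_cont11 (PG _ Pg); have ch := inG_cont11 (PG _ Ph).
by rewrite LfD ?LfZ//; exact: cont11Z.
Qed.

(** Duality sends [x + \sum_j v 0 j * h j x] to [v], and for small [v] this map still belongs to
    [inG]. Leaving [P] abstract covers both [inG0] and [inG00]. *)
Lemma image_interior0 (P : set (R -> R)) (h : 'I_n -> R -> R) (L : 'I_n -> R) :
  (forall j, [/\ lip11 (h j) (L j), h j (-1) = 0, h j 1 = 0 &
    forall i, dint (f i) (h j) = (i == j)%:R]) ->
  (forall c : 'I_n -> R, inG (fun x => x + \sum_j c j * h j x) ->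
    P (fun x => x + \sum_j c j * h j x)) ->
  (Lf f @` P)° 0.
Proof.
move=> hP PP; apply/interior_normP.
pose M := \sum_j `|L j|; have M0 : 0 <= M by apply: sumr_ge0 => j _.
have M1 : 0 < M + 1 by lra.
(* Coordinates are bounded by the norm, so the perturbation has Lipschitz constant at most
   [|v| * M], below the slope 1 of the identity. *)
exists (M + 1)^-1; first by rewrite invr_gt0.
move=> v vM; rewrite add0r; pose k x := \sum_j v 0 j * h j x.
have hL j : lip11 (h j) (L j) by case: (hP j).
have kL : lip11 k (\sum_j `|v 0 j| * L j) by exact: lip11_sum.
exists (fun x => x + k x).
  apply: PP; apply: (inG_perturb (s := 1) (@inG_id R) _ kL) => [x y _ _ _|||].
  - by rewrite mul1r.
  - apply: (@le_lt_trans _ _ (`|v| * M)).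
      rewrite mulr_sumr; apply: ler_sum => j _.
      apply: (@le_trans _ _ (`|v 0 j| * `|L j|)); first by rewrite ler_wpM2l// ler_norm.
      by rewrite ler_wpM2r//; exact: coord_le_norm.
    apply: (@le_lt_trans _ _ (`|v| * (M + 1))); first by rewrite ler_wpM2l//; lra.
    by rewrite -ltr_pdivlMr// mul1r.
  - by rewrite /k big1// => j _; case: (hP j) => _ -> _ _; rewrite mulr0.
  - by rewrite /k big1// => j _; case: (hP j) => _ _ -> _; rewrite mulr0.
rewrite LfD; [|exact: cont11_id|exact: lip11_cont kL].
rewrite Lf_id add0r; apply/rowP => i; rewrite LfE dint_sum//; last first.
  by move=> j; exact: lip11_cont (hL j).
rewrite (bigD1 i)//= big1 ?addr0.
  by case: (hP i) => _ _ _ ->; rewrite eqxx mulr1.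
by move=> j ji; case: (hP j) => _ _ _ ->; rewrite eq_sym (negbTE ji) mulr0.
Qed.

(* An interior value is the value of some [(g + c id) / (1 + c)], whose slope is
   bounded below, so that it can be perturbed inside the kernel of [Lf f]. *)
Lemma image_interior_two p (w : 'I_p -> R -> R) (v : 'rV[R]_n) :
  (Lf f @` [set g | inG0 g])° v ->
  exists g1 g2, [/\ inG0 g1, inG0 g2, Lf f g1 = v, Lf f g2 = v &
    exists2 h, (forall x, g2 x = g1 x + h x) & (forall x, h (- x) = h x) /\ ~ inspan w h].
Proof.
move=> /interior_normP[e e0 eA].
(* This choice gives [c * |v| < e], so that [v + c *: v] is still attained. *)
pose c := e / (`|v| + 1); have v1 : 0 < `|v| + 1 by have := normr_ge0 v; lra.
have c0 : 0 < c by exact: divr_gt0.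
have [|g G0g Lg] := eA (c *: v).
  rewrite normrZ gtr0_norm// mulrAC ltr_pdivrMr// ltr_pM2l//.
  by have := normr_ge0 v; lra.
have Gg : inG g by case: G0g.
pose t := (1 + c)^-1.
have t0 : 0 < t by rewrite invr_gt0; lra.
have t1 : t < 1 by rewrite invf_lt1; lra.
pose g1 x := t * g x + (1 - t) * x.
have G0g1 : inG0 g1 by apply: inG0_conv => //; [exact: inG0_id|lra].
have [Gg1 int_g1] := G0g1.
have L1 : Lf f g1 = v.
  rewrite LfD ?LfZ; try by [exact: cont11_id|exact: inG_cont11|apply: cont11Z; exact: inG_cont11|apply: cont11Z; exact: cont11_id].
  rewrite Lf_id scaler0 addr0 Lg -[X in X + _]scale1r -scalerDl scalerA mulVf ?scale1r//.
  by apply: lt0r_neq0; lra.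
(* Since [dint id] is [int11], including the identity among the functionals makes [h] have integral
   0. *)
have Gid i : inG (with_id f i).
  by rewrite /with_id; case: unliftP => [j _|_] //; exact: inG_id.
have [h [L [hL he h1 hF hw]]] := even_kernel w Gid.
have L0 : 0 < `|L| + 1 by have := normr_ge0 L; lra.
(* The term [(1 - t) * x] gives [g1] slope at least [1 - t]; [d] scales [h] below that bound. *)
pose d := (1 - t) / (`|L| + 1).
have d0 : 0 < d by apply: divr_gt0 => //; lra.
have ch : cont11 (fun x => d * h x) by apply: cont11Z; exact: lip11_cont hL.
have Ld : `|d| * L < 1 - t.
  rewrite gtr0_norm// mulrAC ltr_pdivrMr// ltr_pM2l; last by lra.
  by have := ler_norm L; lra.
have hi i : dint (with_id f i) (fun x => d * h x) = 0.
  by rewrite dintZ// ?hF ?mulr0//; exact: lip11_cont hL.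
exists g1, (fun x => g1 x + d * h x); split => //.
- split.
    apply: (inG_perturb Gg1 _ (lip11Z d hL) Ld); try by rewrite ?he h1 mulr0.
    move=> x y Ix Iy xy; rewrite /g1.
    have : t * g x < t * g y by rewrite ltr_pM2l//; exact: inG_lt.
    by lra.
  rewrite int11D ?int_g1; try by apply: cont11_ig => //; exact: inG_cont11.
  rewrite add0r -dint_id; have := hi ord0.
  by rewrite /with_id unlift_none.
- rewrite LfD//; last exact: inG_cont11.
  rewrite L1 (_ : Lf f _ = 0) ?addr0//; apply/rowP => i.
  by rewrite LfE mxE; have := hi (lift ord0 i); rewrite /with_id liftK.
- exists (fun x => d * h x) => //; split=> [x|[a ha]]; first by rewrite he.
  apply: hw; exists (fun i => d^-1 * a i) => x Ix.
  under eq_bigr do rewrite -mulrA.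
  by rewrite -mulr_sumr -ha// mulKf// lt0r_neq0.
Qed.

(** * Adjoining a function to an independent family *)

Lemma lin_indep_ext p (w : 'I_p -> R -> R) g :
  lin_indep w -> ~ inspan w g -> lin_indep (ext w g).
Proof.
move=> indep span c c0.
have extE t : \sum_i c i * ext w g i t =
    \sum_i c (lift ord_max i) * w i t + c ord_max * g t.
  rewrite big_ord_recr /= {2}/ext unlift_none; congr (_ + _).
  apply: eq_bigr => i _; rewrite (_ : widen_ord _ _ = lift ord_max i).
    by rewrite /ext liftK.
  by apply/val_inj => /=; rewrite /bump leqNgt ltn_ord.
have cmax : c ord_max = 0.
  apply: contra_notP span => /eqP cn0.
  exists (fun i => - (c ord_max)^-1 * c (lift ord_max i)) => t It.
  under eq_bigr do rewrite -mulrA.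
  rewrite -mulr_sumr; have := c0 t It; rewrite extE => /eqP; rewrite addr_eq0 => /eqP ->.
  by rewrite mulrNN mulKf.
have cw : forall i, c (lift ord_max i) = 0.
  by apply: indep => t It; have := c0 t It; rewrite extE cmax mul0r addr0.
by move=> i; case: (unliftP ord_max i) => [j|] ->.
Qed.

(** The identity goes first and the new function last, so the two extensions commute up to index
    shifts. *)
Lemma with_id_ext g : with_id (ext f g) = ext (with_id f) g.
Proof.
apply/funext => i; rewrite /with_id /ext; case: (unliftP ord0 i) => [j ->|->].
  case: (unliftP ord_max j) => [l ->|->].
    rewrite (_ : lift ord0 (lift ord_max l) = lift ord_max (lift ord0 l)) ?liftK//.
    by apply/val_inj; rewrite /= /bump /= !add1n ltnS addnS.
  by rewrite (_ : lift ord0 ord_max = ord_max) ?unlift_none//; apply/val_inj.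
rewrite (_ : ord0 = lift ord_max ord0) ?liftK ?unlift_none//.
by apply/val_inj.
Qed.

Lemma even_part_ext g :
  (fun i => even_part (ext f g i)) = ext (fun i => even_part (f i)) (even_part g).
Proof. by apply/funext => i; rewrite /ext; case: unliftP. Qed.

Lemma ext_inG0 g : inG0 g -> forall i, inG0 (ext f g i).
Proof. by move=> G0g i; rewrite /ext; case: unliftP. Qed.

Lemma inspan_sub p (w : 'I_p -> R -> R) g h : inspan w g -> inspan w h ->
  inspan w (fun x => h x - g x).
Proof.
move=> [a ga] [b hb]; exists (fun i => b i - a i) => t It.
by rewrite ga// hb// -sumrB; apply: eq_bigr => i _; rewrite mulrBl.
Qed.

(** An open set contained in the smaller image lies in its interior, so it suffices to attain each
    interior value by some [g] satisfying [P]. *)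
Lemma interior_image_eq (P : set (R -> R)) :
  (forall v, (Lf f @` [set g | inG0 g])° v -> exists2 g, inG0 g /\ P g & Lf f g = v) ->
  (Lf f @` [set g | inG0 g])° = (Lf f @` [set g | inG0 g /\ P g])°.
Proof.
move=> H; apply/seteqP; split.
- by rewrite -open_subsetE; [move=> v /H|exact: open_interior].
- apply: interiorS => _ [g [G0g _] <-]; by exists g.
Qed.

End Image.

Theorem theorem4p4 (R : realType) (n : nat) (f : 'I_n -> R -> R) :
  (forall i, inG0 (f i)) ->
  (LIN f ->
     convex_set ((Lf f @` [set g | inG0 g])°) /\
     ((Lf f @` [set g | inG0 g])°) 0 /\
     (Lf f @` [set g | inG0 g])° =
       (Lf f @` [set g | inG0 g /\ LIN (ext f g)])°) /\
  (LINp f ->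
     convex_set ((Lf f @` [set g | inG00 g])°) /\
     ((Lf f @` [set g | inG00 g])°) 0 /\
     (Lf f @` [set g | inG0 g])° =
       (Lf f @` [set g | inG0 g /\ LINp (ext f g)])°).
Proof.
move=> G0f; split=> -[_ indep]; split; [|split| |split].
- apply: convex_image_interior => //; first by move=> g [].
  by move=> g h t; exact: inG0_conv.
- have G0id i : inG0 (with_id f i).
    by rewrite /with_id; case: unliftP => [j _|_] //; exact: inG0_id.
  (* Dual functions for [with_id f] are also annihilated by the functional of the identity, so
     adding them to [id] keeps the integral 0. *)
  have [h hP] := choice (fun j => ramp_test G0id indep (lift ord0 j)).
  have [L hL] := choice hP.
  apply: (@image_interior0 R n f G0f _ h L) => [j|c Gc].
    have [? ? ? hj] := hL j; split=> // i.
    have := hj (lift ord0 i); rewrite {1}/with_id liftK => ->.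
    by rewrite (inj_eq lift_inj).
  split=> //; rewrite int11D; [|apply: cont11_ig..]; last 2 first.
  + exact: cont11_id.
  + by apply: cont11_sum => j; apply: cont11Z; have [/lip11_cont] := hL j.
  rewrite int11_sum; last by move=> j; have [/lip11_cont] := hL j.
  rewrite (inG0_id R).2 add0r big1// => j _; have [_ _ _ /(_ ord0)] := hL j.
  by rewrite {1}/with_id unlift_none dint_id => ->; rewrite mulr0.
- apply: interior_image_eq => v /(image_interior_two G0f (with_id f)).
  move=> [g1 [g2 [G1 G2 L1 L2 [h hE [_ hw]]]]].
  have LIN_ext g : inG0 g -> ~ inspan (with_id f) g -> LIN (ext f g).
    move=> G0g gw; split; first exact: ext_inG0.
    by rewrite with_id_ext; exact: lin_indep_ext.
  (* If [g1] and [g2] were both in the span, so would be their difference [h]. *)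
  have [s1|s1] := pselect (inspan (with_id f) g1); last first.
    by exists g1 => //; split=> //; exact: LIN_ext.
  exists g2 => //; split=> //; apply: LIN_ext => // s2; apply: hw.
  have [a ha] := inspan_sub s1 s2; exists a => t It.
  by rewrite -ha// hE; ring.
- apply: convex_image_interior => //; first by move=> g [].
  by move=> g h t; exact: inG00_conv.
- have [h hP] := choice (fun j => oramp_test G0f indep j).
  have [L hL] := choice hP.
  apply: (@image_interior0 R n f G0f _ h L) => [j|c Gc].
    by have [? ho h1 ?] := hL j; split=> //; rewrite ho h1 oppr0.
  split=> // t _; rewrite opprD -sumrN; congr (_ + _).
  by apply: eq_bigr => j _; have [_ -> _ _] := hL j; rewrite mulrN.
- pose w i := even_part (f i).
  apply: interior_image_eq => v /(image_interior_two G0f w).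
  move=> [g1 [g2 [G1 G2 L1 L2 [h hE [he hw]]]]].
  have LINp_ext g : inG0 g -> ~ inspan w (even_part g) -> LINp (ext f g).
    move=> G0g gw; split; first exact: ext_inG0.
    by rewrite even_part_ext; exact: lin_indep_ext.
  have [s1|s1] := pselect (inspan w (even_part g1)); last first.
    by exists g1 => //; split=> //; exact: LINp_ext.
  exists g2 => //; split=> //; apply: LINp_ext => // s2; apply: hw.
  have [a ha] := inspan_sub s1 s2; exists a => t It.
  (* As [h] is even, it is exactly the difference of the even parts of [g2] and [g1]. *)
  by rewrite -ha// /even_part !hE he; field.
Qed.
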